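(* For every real $d$ with $0<d\le 2\ln(3/2)$, $\chi(\mathbb{H}^2,\{d\})\le 12$.
   Context: $\mathbb{H}^2$ is the hyperbolic plane of constant curvature $-1$ with its hyperbolic distance. $\chi(\mathbb{H}^2,\{d\})$ is the chromatic number of the graph with vertex set $\mathbb{H}^2$ in which two points are adjacent iff their hyperbolic distance equals $d$. *)

(* Defs.v *)
From Stdlib Require Import Reals Lra Lia Psatz.
From Coquelicot Require Import Coquelicot.

Open Scope R_scope.

(* A point x + i y, y > 0, of the upper half-plane, with metric
   (dx^2 + dy^2) / y^2 of curvature -1. *)
Record H2 : Type := mkH2 { hx : R; hy : R; hy_pos : 0 < hy }.

(* sinh (dist / 2) = |z - w| / (2 sqrt (Im z Im w)); the more familiar form
   is lemma cosh_hdist. *)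
Definition hdist (z w : H2) : R :=
  2 * arcsinh (sqrt ((hx z - hx w) ^ 2 + (hy z - hy w) ^ 2)
               / (2 * sqrt (hy z * hy w))).

Definition colorable (V : Type) (adj : V -> V -> Prop) (k : nat) : Prop :=
  exists c : V -> nat,
    (forall v, (c v < k)%nat) /\ (forall u v, adj u v -> c u <> c v).

(* Infimum in the extended reals: p_infty when no finite number of colors
   suffices. *)
Definition chromatic_number (V : Type) (adj : V -> V -> Prop) : Rbar :=
  Glb_Rbar (fun r => exists k : nat, r = INR k /\ colorable V adj k).

Definition H2_adj (d : R) (z w : H2) : Prop := hdist z w = d.

Definition chi_H2 (d : R) : Rbar := chromatic_number H2 (H2_adj d).

Lemma cosh_hdist (z w : H2) :
  cosh (hdist z w) =
  1 + ((hx z - hx w) ^ 2 + (hy z - hy w) ^ 2) / (2 * hy z * hy w).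
Proof.
assert (dbl : forall t, cosh (2 * t) = 1 + 2 * (sinh t) ^ 2).
{ intros t. unfold cosh, sinh.
  replace (2 * t) with (t + t) by ring.
  replace (- (t + t)) with (- t + - t) by ring.
  rewrite !exp_plus.
  assert (h : exp t * exp (- t) = 1)
    by (rewrite <- exp_plus, Rplus_opp_r; apply exp_0).
  nra. }
unfold hdist. rewrite dbl, sinh_arcsinh.
destruct z as [x y py], w as [x' y' py']; simpl hx; simpl hy.
assert (hyy : 0 < y * y') by (apply Rmult_lt_0_compat; assumption).
unfold Rdiv. rewrite Rpow_mult_distr, pow_inv, Rpow_mult_distr.
rewrite !pow2_sqrt; [field; split; lra | lra | apply Rplus_le_le_0_compat; apply pow2_ge_0].
Qed.

Lemma chromatic_number_le (V : Type) (adj : V -> V -> Prop) (n : nat) :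
  Rbar_le (chromatic_number V adj) (INR n) <-> colorable V adj n.
Proof.
unfold chromatic_number.
destruct (Glb_Rbar_correct
  (fun r => exists k : nat, r = INR k /\ colorable V adj k)) as [lb glb].
split.
- intros le.
  destruct (Classical_Prop.classic (colorable V adj n)) as [yes | no];
    [exact yes | exfalso].
  assert (le' : Rbar_le (INR (S n)) (INR n)).
  { apply Rbar_le_trans with (2 := le), glb.
    intros r [k [-> [c [cb cp]]]]. apply le_INR.
    destruct (Nat.le_gt_cases (S n) k) as [h | h]; [exact h | exfalso].
    apply no. exists c. split; [| exact cp].
    intros v. specialize (cb v). lia. }
  rewrite S_INR in le'. simpl in le'. lra.
- intros col. apply lb. exists n. split; [reflexivity | exact col].
Qed.

(* Main.v *)
Require Import Defs.
From Stdlib Require Import Reals.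
From Coquelicot Require Import Coquelicot.
From Stdlib Require Import Lra Lia Psatz ZArith.
Open Scope R_scope.

(** Put [H = exp (d / 2)].  Cut the half-plane into the horocyclic strips
    [H ^ k <= y < H ^ (k + 1)], and the [k]-th strip into cells of Euclidean
    width [(H ^ 2 - 1) / 2 * H ^ k].  A cell has hyperbolic diameter at most [d],
    not attained because cells are half-open.  Two cells of one strip whose
    indices differ by at least 3, and two strips whose indices differ by at
    least 3, are more than [d] apart.  Hence the indices of the strip and of the
    cell modulo 3 form a proper coloring, with 9 colors, as long as [H <= 2]. *)

(** With [H = exp (d / 2)] one has [cosh d - 1 = (H ^ 2 - 1) ^ 2 / (2 * H ^ 2)]; clearing
    denominators in [cosh_hdist] leaves this polynomial equation. The estimates below contradict it
    by a strict inequality one way (too far) or the other (too close). *)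
Lemma H2_adj_quadratic (d : R) (z w : H2) :
  H2_adj d z w ->
  exp (d / 2) ^ 2 * ((hx z - hx w) ^ 2 + (hy z - hy w) ^ 2) =
  (exp (d / 2) ^ 2 - 1) ^ 2 * (hy z * hy w).
Proof.
intros adj. pose proof (cosh_hdist z w) as E. rewrite adj in E.
unfold cosh in E. rewrite exp_Ropp in E.
replace (exp d) with (exp (d / 2) ^ 2) in E
  by (simpl; rewrite Rmult_1_r, <- exp_plus; f_equal; field).
pose proof (exp_pos (d / 2)) as Hp.
pose proof (hy_pos z) as pz. pose proof (hy_pos w) as pw.
set (H := exp (d / 2)) in *.
set (S := (hx z - hx w) ^ 2 + (hy z - hy w) ^ 2) in *.
assert (ES : S = 2 * hy z * hy w * ((H ^ 2 + / H ^ 2) / 2 - 1))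
  by (rewrite E; field; lra).
rewrite ES. field. lra.
Qed.

Lemma strips_far (H dx y y' : R) :
  1 < H -> 0 < y -> H ^ 2 * y < y' ->
  (H ^ 2 - 1) ^ 2 * (y * y') < H ^ 2 * (dx ^ 2 + (y - y') ^ 2).
Proof.
intros h1 py hy.
assert (0 <= H ^ 2 * dx ^ 2) by (rewrite <- Rpow_mult_distr; apply pow2_ge_0).
assert (1 < H ^ 2) by nra.
(* For [dx = 0], right side minus left side of the goal is exactly this product. *)
assert (0 < (H ^ 2 * y' - y) * (y' - H ^ 2 * y))
  by (assert (y < y') by nra; apply Rmult_lt_0_compat; nra).
nra.
Qed.

(** The horizontal gap suffices: [(H ^ 2 - 1) * b] is two cell widths, and both heights are below
    [H * b]. *)
Lemma cells_far (H b dx y y' : R) :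
  1 < H -> 0 < y < H * b -> 0 < y' < H * b -> (H ^ 2 - 1) * b < Rabs dx ->
  (H ^ 2 - 1) ^ 2 * (y * y') < H ^ 2 * (dx ^ 2 + (y - y') ^ 2).
Proof.
intros h1 hy hy' hdx.
assert (pb : 0 < b) by nra.
assert (1 < H ^ 2) by nra.
assert (yy : y * y' < (H * b) * (H * b)) by (apply Rmult_le_0_lt_compat; lra).
assert (xx : ((H ^ 2 - 1) * b) ^ 2 < dx ^ 2).
{ rewrite <- (pow2_abs dx).
  assert (0 < (H ^ 2 - 1) * b) by (apply Rmult_lt_0_compat; lra). nra. }
apply Rlt_trans with (H ^ 2 * ((H ^ 2 - 1) * b) ^ 2).
- replace (H ^ 2 * ((H ^ 2 - 1) * b) ^ 2)
    with ((H ^ 2 - 1) ^ 2 * ((H * b) * (H * b))) by ring.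
  apply Rmult_lt_compat_l; [nra | exact yy].
- apply Rmult_lt_compat_l; [lra |]. pose proof (pow2_ge_0 (y - y')). lra.
Qed.

Lemma cell_diagonal (H y y' : R) :
  1 < H <= 2 -> 0 < y -> y <= y' <= H * y ->
  H ^ 2 * (((H ^ 2 - 1) / 2 * y) ^ 2 + (y - y') ^ 2) <=
  (H ^ 2 - 1) ^ 2 * (y * y').
Proof.
intros [h1 h2] py [l u].
(* The difference is concave in [y'] and nonnegative at both ends. *)
set (G := fun v => (H ^ 2 - 1) ^ 2 * (y * v) -
  H ^ 2 * (((H ^ 2 - 1) / 2 * y) ^ 2 + (y - v) ^ 2)).
(* Two points at equal height, one cell width apart: here [H <= 2] is exactly what makes
   [1 - H ^ 2 / 4] nonnegative. *)
assert (g1 : 0 <= G y).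
{ replace (G y) with (((H ^ 2 - 1) * y) ^ 2 * (1 - H ^ 2 / 4))
    by (unfold G; field).
  apply Rmult_le_pos; [apply pow2_ge_0 | nra]. }
assert (g2 : 0 <= G (H * y)).
{ replace (G (H * y))
    with (((H - 1) * y) ^ 2 * (H * ((H + 1) ^ 2 * (4 - H) / 4 - H)))
    by (unfold G; field).
  apply Rmult_le_pos; [apply pow2_ge_0 | apply Rmult_le_pos; nra]. }
(* [G] is quadratic with leading coefficient [- H ^ 2], so it exceeds its chord by
   [H ^ 2 * (y' - y) * (H * y - y')]. *)
assert (conc : (H - 1) * y * G y' =
  (H * y - y') * G y + (y' - y) * G (H * y) +
  H ^ 2 * ((H - 1) * y) * ((y' - y) * (H * y - y')))
  by (unfold G; field).
assert (pos : 0 < (H - 1) * y) by (apply Rmult_lt_0_compat; lra).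
assert (0 <= (H - 1) * y * G y').
{ rewrite conc.
  repeat apply Rplus_le_le_0_compat; repeat apply Rmult_le_pos; nra. }
assert (0 <= G y') by (apply Rmult_le_reg_l with (1 := pos); lra).
unfold G in *; lra.
Qed.

(** Replacing [b] by the lower of the two heights only widens the cell, so [cell_diagonal] applies;
    strictness comes from the bound on [dx]. *)
Lemma cell_close (H b dx y y' : R) :
  1 < H <= 2 -> 0 < b -> b <= y < H * b -> b <= y' < H * b ->
  Rabs dx < (H ^ 2 - 1) / 2 * b ->
  H ^ 2 * (dx ^ 2 + (y - y') ^ 2) < (H ^ 2 - 1) ^ 2 * (y * y').
Proof.
assert (ordered : forall y y', 1 < H <= 2 -> 0 < b -> b <= y -> y <= y' ->
  y' < H * b -> Rabs dx < (H ^ 2 - 1) / 2 * b ->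
  H ^ 2 * (dx ^ 2 + (y - y') ^ 2) < (H ^ 2 - 1) ^ 2 * (y * y')).
{ clear y y'. intros y y' hH pb by_ yy' y'b hdx.
  assert (hyH : y' <= H * y) by nra.
  assert (sq : 1 < H ^ 2) by nra.
  assert (xx : dx ^ 2 < ((H ^ 2 - 1) / 2 * y) ^ 2).
  { rewrite <- (pow2_abs dx). pose proof (Rabs_pos dx).
    assert ((H ^ 2 - 1) / 2 * b <= (H ^ 2 - 1) / 2 * y)
      by (apply Rmult_le_compat_l; lra).
    nra. }
  apply Rlt_le_trans with (2 := cell_diagonal H y y' hH ltac:(lra) (conj yy' hyH)).
  apply Rmult_lt_compat_l; lra. }
intros hH pb hy hy' hdx.
destruct (Rle_dec y y') as [le | gt].
- apply ordered; tauto.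
- replace ((y - y') ^ 2) with ((y' - y) ^ 2) by ring.
  rewrite (Rmult_comm y). apply ordered; tauto || lra.
Qed.

Lemma Int_part_eq_dist (a b : R) :
  Int_part a = Int_part b -> Rabs (a - b) < 1.
Proof.
intros e. destruct (base_Int_part a), (base_Int_part b).
rewrite e in *. apply Rabs_def1; lra.
Qed.

(** Rounding down loses less than 1, so an index gap of 3 guarantees a real gap above 2; hence the
    residues modulo 3. *)
Lemma Int_part_far (a b : R) :
  (Int_part a + 3 <= Int_part b)%Z -> 2 < b - a.
Proof.
intros le. destruct (base_Int_part a), (base_Int_part b).
apply IZR_le in le. rewrite plus_IZR in le. lra.
Qed.

Lemma mod3_cases (a b : Z) :
  (a mod 3 = b mod 3)%Z -> (a = b \/ a + 3 <= b \/ b + 3 <= a)%Z.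
Proof. intros e. Z.div_mod_to_equations. lia. Qed.

Definition strip (d : R) (z : H2) : Z := Int_part (ln (hy z) / (d / 2)).

(** This is [H ^ k] for the strip index [k], written through [exp] because [k] may be negative. *)
Definition strip_base (d : R) (z : H2) : R := exp (IZR (strip d z) * (d / 2)).

Definition cell_width (d : R) (z : H2) : R :=
  (exp (d / 2) ^ 2 - 1) / 2 * strip_base d z.

Definition cell (d : R) (z : H2) : Z := Int_part (hx z / cell_width d z).

Lemma strip_bounds (d : R) (z : H2) :
  0 < d -> strip_base d z <= hy z < exp (d / 2) * strip_base d z.
Proof.
intros hd. unfold strip_base, strip. pose proof (hy_pos z) as p.
set (l := ln (hy z) / (d / 2)). destruct (base_Int_part l) as [lo up].
rewrite <- exp_plus.
assert (e : ln (hy z) = l * (d / 2)) by (unfold l; field; lra).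
rewrite <- (exp_ln (hy z) p), e.
split.
- destruct lo as [lo | lo]; [left; apply exp_increasing | right; f_equal]; nra.
- apply exp_increasing. nra.
Qed.

Lemma strip_far (d : R) (z w : H2) :
  0 < d -> (strip d z + 3 <= strip d w)%Z -> exp (d / 2) ^ 2 * hy z < hy w.
Proof.
intros hd le. apply Int_part_far in le.
assert (e : ln (hy w) - ln (hy z) =
  (ln (hy w) / (d / 2) - ln (hy z) / (d / 2)) * (d / 2)) by (field; lra).
rewrite <- (exp_ln (hy w) (hy_pos w)), <- (exp_ln (hy z) (hy_pos z)).
simpl. rewrite Rmult_1_r, <- !exp_plus. apply exp_increasing. nra.
Qed.

Lemma strip_far_not_adj (d : R) (z w : H2) :
  0 < d -> (strip d z + 3 <= strip d w)%Z ->
  ~ H2_adj d z w /\ ~ H2_adj d w z.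
Proof.
intros hd far. apply (strip_far d z w hd) in far.
assert (h1 : 1 < exp (d / 2)) by (rewrite <- exp_0; apply exp_increasing; lra).
split; intros adj; apply H2_adj_quadratic in adj.
- pose proof (strips_far _ (hx z - hx w) _ _ h1 (hy_pos z) far). lra.
- pose proof (strips_far _ (hx w - hx z) _ _ h1 (hy_pos z) far). nra.
Qed.

Lemma strip_same_not_adj (d : R) (z w : H2) :
  0 < d -> exp (d / 2) <= 2 -> strip d z = strip d w ->
  (cell d z mod 3 = cell d w mod 3)%Z -> ~ H2_adj d z w.
Proof.
intros hd h2 es ec adj. apply H2_adj_quadratic in adj.
assert (h1 : 1 < exp (d / 2)) by (rewrite <- exp_0; apply exp_increasing; lra).
pose proof (strip_bounds d z hd) as bz. pose proof (strip_bounds d w hd) as bw.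
assert (eb : strip_base d w = strip_base d z)
  by (unfold strip_base; rewrite es; reflexivity).
unfold cell, cell_width in ec. rewrite eb in bw, ec.
assert (pb : 0 < strip_base d z) by apply exp_pos.
pose proof (hy_pos z) as pz. pose proof (hy_pos w) as pw.
set (b := strip_base d z) in *. set (H := exp (d / 2)) in *.
set (W := (H ^ 2 - 1) / 2 * b) in *.
assert (pW : 0 < W) by (apply Rmult_lt_0_compat; nra).
assert (e : hx z - hx w = (hx z / W - hx w / W) * W) by (field; lra).
(* More than two widths [W] apart means [dx] beyond [(H ^ 2 - 1) * b], the threshold of
   [cells_far]. *)
assert (far : 2 < Rabs (hx z / W - hx w / W) -> False).
{ intros f.
  assert (l : (H ^ 2 - 1) * b < Rabs (hx z - hx w)).
  { rewrite e, Rabs_mult, (Rabs_pos_eq W) by lra.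
    replace ((H ^ 2 - 1) * b) with (2 * W) by (unfold W; field).
    apply Rmult_lt_compat_r; assumption. }
  pose proof (cells_far H b _ (hy z) (hy w) h1 ltac:(lra) ltac:(lra) l). lra. }
destruct (mod3_cases _ _ ec) as [eq | [lt | gt]].
- apply Int_part_eq_dist in eq.
  assert (l : Rabs (hx z - hx w) < W).
  { rewrite e, Rabs_mult, (Rabs_pos_eq W) by lra. nra. }
  pose proof (cell_close H b _ _ _ (conj h1 h2) pb bz bw l). lra.
- apply far. apply Int_part_far in lt. rewrite Rabs_minus_sym.
  apply Rlt_le_trans with (1 := lt), Rle_abs.
- apply far. apply Int_part_far in gt.
  apply Rlt_le_trans with (1 := gt), Rle_abs.
Qed.

Lemma colorable_H2_9 (d : R) :
  0 < d -> d <= 2 * ln 2 -> colorable H2 (H2_adj d) 9.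
Proof.
intros hd0 hd.
assert (h2 : exp (d / 2) <= 2).
{ apply Rle_trans with (exp (ln 2)); [| rewrite exp_ln; lra].
  destruct (Rle_lt_or_eq_dec _ _ hd) as [lt | eq];
    [left; apply exp_increasing | right; f_equal]; lra. }
(* The two residues are the base 3 digits of the color, so equal colors give equal residues. *)
exists (fun z => Z.to_nat (3 * (strip d z mod 3) + cell d z mod 3)).
split.
- intros z. Z.div_mod_to_equations. lia.
- intros z w adj e.
  assert (es : (strip d z mod 3 = strip d w mod 3)%Z)
    by (Z.div_mod_to_equations; lia).
  assert (ec : (cell d z mod 3 = cell d w mod 3)%Z)
    by (Z.div_mod_to_equations; lia).
  destruct (mod3_cases _ _ es) as [eq | [lt | gt]].
  + exact (strip_same_not_adj d z w hd0 h2 eq ec adj).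
  + exact (proj1 (strip_far_not_adj d z w hd0 lt) adj).
  + exact (proj2 (strip_far_not_adj d w z hd0 gt) adj).
Qed.

Lemma colorable_mono (V : Type) (adj : V -> V -> Prop) (k l : nat) :
  (k <= l)%nat -> colorable V adj k -> colorable V adj l.
Proof.
intros le [c [cb cp]]. exists c. split; [| exact cp].
intros v. exact (Nat.lt_le_trans _ _ _ (cb v) le).
Qed.

Theorem theorem2p2 (d : R) (hd0 : 0 < d) (hd : d <= 2 * ln (3 / 2)) :
  Rbar_le (chi_H2 d) (Finite 12).
Proof.
replace (Finite 12) with (Finite (INR 12)) by (f_equal; simpl; ring).
(* Nine colors already work up to [2 * ln 2], which exceeds [2 * ln (3 / 2)]. *)
apply chromatic_number_le, (colorable_mono _ _ 9); [lia |].
apply colorable_H2_9; [exact hd0 |].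
assert (ln (3 / 2) < ln 2) by (apply ln_increasing; lra). lra.
Qed.
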